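(* The minimal number of directions in a set $G\subset\mathbb{S}^{d-1}$ required to satisfy both (C1) the open half-spaces $H_u$ with $u\in G$ cover $\mathbb{S}^{d-1}$, and (C2) the reflections $\{R_u\mid u\in G\}$ generate a dense subgroup of $O(d)$, is $d+1$. That is, every $G\subset\mathbb{S}^{d-1}$ satisfying (C1) and (C2) has at least $d+1$ elements, and there exists a set $G\subset\mathbb{S}^{d-1}$ with exactly $d+1$ elements that satisfies (C1) and (C2).
   Context: $\mathbb{S}^{d-1}$ is the set of unit vectors in $\mathbb{R}^d$; $O(d)$ is the group of orthogonal linear transformations of $\mathbb{R}^d$. For $u\in\mathbb{S}^{d-1}$: $R_u x=x-2(x\cdot u)u$ is the reflection about $u^\perp$ and $H_u=\{x\in\mathbb{R}^d\mid x\cdot u>0\}$. *)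

(* Defs.v *)
From mathcomp Require Import all_boot all_order all_algebra.
From mathcomp Require Import all_classical all_reals all_analysis.
From mathcomp Require Import ring.

Set Implicit Arguments.
Unset Strict Implicit.
Unset Printing Implicit Defensive.

Import Order.TTheory GRing.Theory Num.Theory.
Import numFieldNormedType.Exports.

Local Open Scope classical_set_scope.
Local Open Scope ring_scope.

Section Reflections.
Variables (R : realType) (d : nat).
Implicit Types (u x y : 'rV[R]_d) (A B : 'M[R]_d) (G : set 'rV[R]_d).

Definition dotv x y : R := \sum_(i < d) x 0 i * y 0 i.

(* Euclidean unit vectors; the library norm on 'rV[R]_d is the sup norm. *)
Definition sphere : set 'rV[R]_d := [set x | Num.sqrt (dotv x x) = 1].

Definition halfspace u : set 'rV[R]_d := [set x | 0 < dotv x u].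

Definition refl u x : 'rV[R]_d := x - (2 * dotv x u) *: u.

(* A linear transformation of R^d is represented by the matrix acting on row
   vectors by right multiplication (see [mul_reflmx]).  *)
Definition reflmx u : 'M[R]_d := lin1_mx (refl u).

Definition orthogonal_group : set 'M[R]_d := [set A | A *m A^T = 1%:M].

Definition orthogonal_subgroup (H : set 'M[R]_d) : Prop :=
  [/\ H `<=` orthogonal_group,
      H 1%:M,
      (forall A B, H A -> H B -> H (A *m B)) &
      (forall A, H A -> H (invmx A))].

Definition refl_group G : set 'M[R]_d :=
  smallest orthogonal_subgroup (reflmx @` G).

(* The closure is taken in 'M[R]_d, hence for entrywise convergence. *)
Definition dense_in_orthogonal (H : set 'M[R]_d) : Prop :=
  H `<=` orthogonal_group /\ orthogonal_group `<=` closure H.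

Definition halfspaces_cover G : Prop :=
  sphere `<=` \bigcup_(u in G) halfspace u.

Definition reflections_generate_dense G : Prop :=
  dense_in_orthogonal (refl_group G).

Lemma mul_reflmx u x : x *m reflmx u = refl u x.
Proof.
have dotvD a y z : dotv (a *: y + z) u = a * dotv y u + dotv z u.
  rewrite /dotv mulr_sumr -big_split; apply: eq_bigr => i _ /=.
  by rewrite !mxE mulrDl mulrA.
have reflD a y z : refl u (a *: y + z) = a *: refl u y + refl u z.
  rewrite /refl dotvD scalerBr scalerA mulrDr scalerDl mulrCA.
  by rewrite opprD addrACA.
have refl0 : refl u 0 = 0.
  rewrite /refl /dotv big1 ?mulr0 ?scale0r ?subr0 // => i _.
  by rewrite mxE mul0r.
have reflS (I : seq 'I_d) (a : 'I_d -> R) :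
    refl u (\sum_(i <- I) a i *: delta_mx 0 i) =
    \sum_(i <- I) a i *: refl u (delta_mx 0 i).
  elim: I => [|i I IH]; first by rewrite !big_nil.
  by rewrite !big_cons reflD IH.
rewrite {2}(row_sum_delta x) reflS; apply/rowP => j.
rewrite mxE summxE; apply: eq_bigr => i _.
by rewrite !mxE.
Qed.

Lemma reflmx_orthogonal u : sphere u -> orthogonal_group (reflmx u).
Proof.
move=> /= u1.
have uu : dotv u u = 1.
  have uu0 : 0 <= dotv u u by apply: sumr_ge0 => i _; rewrite -expr2 sqr_ge0.
  by rewrite -(sqr_sqrtr uu0) u1 expr1n.
have E : reflmx u = 1%:M - 2 *: (u^T *m u).
  apply/matrixP => i j; rewrite !mxE eqxx big_ord1 !mxE mulrA.
  congr (_ - _ * _ * _); first by rewrite eq_sym.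
  rewrite /dotv (bigD1 i) //= big1 ?addr0 => [|k ki]; rewrite !mxE.
    by rewrite !eqxx mul1r.
  by rewrite (negPf ki) andbF mul0r.
have uuT : u *m u^T = 1%:M.
  rewrite [LHS]mx11_scalar -uu mxE; congr (_%:M).
  by apply: eq_bigr => j _; rewrite mxE.
have PP : u^T *m u *m (u^T *m u) = u^T *m u.
  by rewrite mulmxA -(mulmxA _ u) uuT mulmx1.
have ET : (1%:M - 2 *: (u^T *m u))^T = 1%:M - 2 *: (u^T *m u).
  by apply/matrixP => i j; rewrite !mxE !big_ord1 !mxE eq_sym (mulrC (u 0 j)).
rewrite /orthogonal_group /= E ET mulmxBr mulmx1 mulmxBl mul1mx.
rewrite -scalemxAr -scalemxAl PP; apply/matrixP => i j; rewrite !mxE; ring.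
Qed.

End Reflections.

(* Main.v *)
(* At least d + 1 directions are needed: given d directions, seen as the rows of
   a square matrix M, either M has a nontrivial kernel or M x = (-1, ..., -1) is
   solvable, so some x <> 0 lies in none of the open half-spaces.

   For d + 1 directions, put s = sqrt 2 - 1 and take u_0 = e_0,
   u_k = cos (pi s) e_(k-1) + sin (pi s) e_k for 0 < k < d, and the direction
   opposite to u_0 + ... + u_(d-1).  They cover because the u_k span R^d.  In
   the plane of e_(k-1) and e_k, the angles t whose reflection is in the closure K
   of the generated group are stable under t, u |-> 2 t - u, and hence admit
   2 pi and 2 pi s as periods.  As s ^ 2 = 1 - 2 s, the 2 pi s ^ n are periods
   too; they tend to 0, so K contains every reflection of that plane.  These
   reflections generate O(d). *)
Require Import Defs.
From mathcomp Require Import all_boot all_order all_algebra.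
From mathcomp Require Import all_classical all_reals all_analysis.
From mathcomp Require Import ring lra.

Set Implicit Arguments.
Unset Strict Implicit.
Unset Printing Implicit Defensive.

Import Order.TTheory GRing.Theory Num.Theory.
Import numFieldNormedType.Exports.

Local Open Scope classical_set_scope.
Local Open Scope ring_scope.

(** * Inner product, reflections and generators of O(d) *)

Section EuclideanGeometry.
Variables (R : realType) (d : nat).
Implicit Types (u v x y z : 'rV[R]_d) (A B : 'M[R]_d) (a b : R).

Lemma dotvC x y : dotv x y = dotv y x.
Proof. by apply: eq_bigr => i _; rewrite mulrC. Qed.

Lemma dotvDl x y z : dotv (x + y) z = dotv x z + dotv y z.
Proof. by rewrite -big_split; apply: eq_bigr => i _; rewrite mxE mulrDl. Qed.

Lemma dotvZl a x z : dotv (a *: x) z = a * dotv x z.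
Proof. by rewrite mulr_sumr; apply: eq_bigr => i _; rewrite mxE mulrA. Qed.

Lemma dotvNl x z : dotv (- x) z = - dotv x z.
Proof. by rewrite -scaleN1r dotvZl mulN1r. Qed.

Lemma dotvDr x y z : dotv z (x + y) = dotv z x + dotv z y.
Proof. by rewrite dotvC dotvDl !(dotvC z). Qed.

Lemma dotvZr a x z : dotv z (a *: x) = a * dotv z x.
Proof. by rewrite dotvC dotvZl (dotvC z). Qed.

Lemma dotvNr x z : dotv z (- x) = - dotv z x.
Proof. by rewrite dotvC dotvNl (dotvC z). Qed.

Definition dotvE := (dotvDl, dotvDr, dotvNl, dotvNr, dotvZl, dotvZr).

Lemma dotv0l x : dotv 0 x = 0.
Proof. by rewrite -(scale0r 0) dotvZl mul0r. Qed.

Lemma dotv_suml n (F : 'I_n -> 'rV[R]_d) x :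
  dotv (\sum_(i < n) F i) x = \sum_(i < n) dotv (F i) x.
Proof.
elim/big_rec2 : _ => [|i a y _ <-]; first exact: dotv0l.
by rewrite dotvDl.
Qed.

Lemma dotv_ge0 x : 0 <= dotv x x.
Proof. by apply: sumr_ge0 => i _; rewrite -expr2 sqr_ge0. Qed.

Lemma dotv_eq0 x : dotv x x = 0 -> x = 0.
Proof.
move=> /eqP; rewrite psumr_eq0 => [/allP x0|i _];
  last by rewrite -expr2 sqr_ge0.
apply/rowP => i; rewrite mxE; apply/eqP.
by have := x0 i (mem_index_enum i); rewrite /= mulf_eq0 orbb.
Qed.

Lemma dotv_gt0 x : x != 0 -> 0 < dotv x x.
Proof.
move=> x0; rewrite lt_neqAle dotv_ge0 andbT eq_sym.
by apply: contra_neq x0 => /dotv_eq0.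
Qed.

Lemma sphereE u : @sphere R d u <-> dotv u u = 1.
Proof.
rewrite /sphere /=; split=> [u1|->]; last by rewrite sqrtr1.
by rewrite -(sqr_sqrtr (dotv_ge0 u)) u1 expr1n.
Qed.

Lemma normalized x : x != 0 -> exists2 c, 0 < c & @sphere R d (c *: x).
Proof.
move=> /dotv_gt0 x0; exists (Num.sqrt (dotv x x))^-1.
  by rewrite invr_gt0 sqrtr_gt0.
apply/sphereE; rewrite !dotvE mulrA -expr2 exprVn sqr_sqrtr ?dotv_ge0 //.
by rewrite mulVf // gt_eqF.
Qed.

Lemma mx_row_eq A B : (forall x, x *m A = x *m B) -> A = B.
Proof. by move=> /mulmxP/eqP. Qed.

Lemma dotv_mul A x y :
  @orthogonal_group R d A -> dotv (x *m A) (y *m A) = dotv x y.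
Proof.
have dotvM v w : dotv v w = (v *m w^T) 0 0.
  by rewrite mxE; apply: eq_bigr => i _; rewrite mxE.
by move=> AA; rewrite !dotvM trmx_mul mulmxA -(mulmxA x) AA mulmx1.
Qed.

Lemma orthogonal_mul A B : @orthogonal_group R d A ->
  @orthogonal_group R d B -> @orthogonal_group R d (A *m B).
Proof.
rewrite /orthogonal_group /= => AA BB.
by rewrite trmx_mul mulmxA -(mulmxA A) BB mulmx1.
Qed.

Lemma reflmxK u : @sphere R d u -> reflmx u *m reflmx u = 1%:M.
Proof.
move=> /sphereE u1; apply: mx_row_eq => x.
rewrite mulmxA !mul_reflmx mulmx1 /refl !dotvE u1 -addrA -opprD -scalerDl.
by rewrite mulr1 (_ : 2 * _ + _ = 0) ?scale0r ?subr0 //; ring.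
Qed.

Lemma reflmxN u : reflmx (- u) = reflmx u.
Proof.
apply: mx_row_eq => x.
by rewrite !mul_reflmx /refl dotvNr mulrN scaleNr scalerN opprK.
Qed.

(** As R_u is self-adjoint, the coefficient (R_u x) . v equals x . (R_u v); as it is an involution,
    the outer factors cancel on x and carry the normal v to R_u v. *)
Lemma reflmx_conj u v : @sphere R d u ->
  reflmx u *m reflmx v *m reflmx u = reflmx (refl u v).
Proof.
move=> u1; have ru x y : dotv (refl u x) y = dotv x (refl u y).
  by rewrite /refl !dotvE (dotvC u); ring.
apply: mx_row_eq => x; rewrite !mulmxA !mul_reflmx {2}/refl -mul_reflmx mulmxBl.
rewrite -scalemxAl !mul_reflmx ru -!mul_reflmx -mulmxA reflmxK // mulmx1.
by rewrite !mul_reflmx {3}/refl.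
Qed.

(** Indices in [nat] allow [k] and [k.+1] without ordinal casts; the vector is 0 once [k >= d]. *)
Definition ev (k : nat) : 'rV[R]_d := \row_(j < d) (j == k :> nat)%:R.

Lemma dotv_ev x (i : 'I_d) : dotv x (ev i) = x 0 i.
Proof.
rewrite /dotv (bigD1 i) //= big1 ?addr0 => [|k ki]; rewrite !mxE.
  by rewrite eqxx mulr1.
by rewrite (negPf ki : (k == i :> nat) = false) mulr0.
Qed.

Lemma dotv_evv (i j : nat) : (j < d)%N -> dotv (ev i) (ev j) = (j == i)%:R.
Proof. by move=> jd; rewrite (dotv_ev _ (Ordinal jd)) mxE. Qed.

Lemma row_ev_eq x y : (forall i : 'I_d, dotv x (ev i) = dotv y (ev i)) -> x = y.
Proof. by move=> xy; apply/rowP => i; rewrite -!dotv_ev xy. Qed.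

Lemma mx_ev_eq A B : (forall i : 'I_d, ev i *m A = ev i *m B) -> A = B.
Proof.
move=> AB; apply/row_matrixP => i; rewrite !rowE.
suff -> : delta_mx 0 i = ev i by exact: AB.
by apply/rowP => j; rewrite !mxE eqxx.
Qed.

(** The reflection exchanging x and y degenerates to the identity when x = y. The normal is recorded
    so that membership of [A] in a given set can be read off from it. *)
Variant swap_spec x y A : Prop :=
| SwapId of x = y & A = 1%:M
| SwapRefl u a of @sphere R d u & u = a *: (x - y) & A = reflmx u.

(** For vectors of equal length, 2 x . (x - y) = |x - y| ^ 2, so reflecting x along the normalized x
    - y subtracts exactly x - y. *)
Lemma swapP x y : dotv x x = dotv y y ->
  exists2 A, swap_spec x y A & x *m A = y.
Proof.
move=> xy; have [<-|nxy] := eqVneq x y.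
  by exists 1%:M; [left|rewrite mulmx1].
have z0 : x - y != 0 by rewrite subr_eq0.
have [a a0 u1] := normalized z0.
exists (reflmx (a *: (x - y))); first exact: (SwapRefl u1 erefl).
rewrite mul_reflmx /refl scalerA.
have := u1 => /sphereE; rewrite !dotvE (dotvC y x) -xy => u2.
rewrite (_ : _ * a = 1) ?scale1r ?subKr // -[RHS]u2.
ring.
Qed.

Lemma swap_fix x y z A : swap_spec x y A ->
  dotv z x = 0 -> dotv z y = 0 -> z *m A = z.
Proof.
case=> [_ ->|u a _ -> ->] zx zy; first by rewrite mulmx1.
by rewrite mul_reflmx /refl !dotvE zx zy subr0 !mulr0 scale0r subr0.
Qed.

Lemma swap_orthogonal x y A : swap_spec x y A -> @orthogonal_group R d A.
Proof.
case=> [_ ->|u a u1 _ ->]; last exact: reflmx_orthogonal.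
by rewrite /orthogonal_group /= trmx1 mulmx1.
Qed.

Lemma swapK x y A : swap_spec x y A -> A *m A = 1%:M.
Proof. by case=> [_ ->|u a u1 _ ->]; [rewrite mulmx1|rewrite reflmxK]. Qed.

(* Induction on the number k of basis vectors that A may move.  To send the
   image of the last of them, e_(k-1), back to e_(k-1), first move its component
   along e_0, ..., e_(k-2) onto the axis of e_(k-2), by induction; one reflection
   in the plane of e_(k-2) and e_(k-1) then suffices. *)
Lemma orthogonal_generated (K : set 'M[R]_d) :
    K 1%:M -> (forall A B, K A -> K B -> K (A *m B)) ->
    ((0 < d)%N -> K (reflmx (ev 0))) ->
    (forall k a b, (k.+1 < d)%N -> a ^+ 2 + b ^+ 2 = 1 ->
       K (reflmx (a *: ev k + b *: ev k.+1))) ->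
  @orthogonal_group R d `<=` K.
Proof.
move=> K1 KM K0 Kc.
suff H k A : (k <= d)%N -> @orthogonal_group R d A ->
    (forall i : 'I_d, (k <= i)%N -> ev i *m A = ev i) -> K A.
  by move=> A OA; apply: (H d A) => // i; rewrite leqNgt ltn_ord.
elim: k A => [|k IH] A kd OA fA.
  suff -> : A = 1%:M by [].
  by apply: mx_ev_eq => i; rewrite fA // mulmx1.
set x := ev k *m A.
have x1 : dotv x x = 1 by rewrite dotv_mul // dotv_evv // eqxx.
have xi (i : 'I_d) : (k < i)%N -> dotv x (ev i) = 0.
  by move=> ki; rewrite -(fA i ki) dotv_mul // dotv_evv // gtn_eqF.
(* A = (A B) C, where A B also fixes e_k and so falls under the induction hypothesis. [K] is not
   assumed stable under inverses, hence the separate C. *)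
suff [B [C [KB KC BC xB fB]]] : exists B C, [/\ K C, @orthogonal_group R d B,
    B *m C = 1%:M, x *m B = ev k &
    forall i : 'I_d, (k < i)%N -> ev i *m B = ev i].
  rewrite -[A]mulmx1 -BC mulmxA; apply: (KM) => //; apply: IH; first exact: ltnW.
    exact: orthogonal_mul.
  move=> i; rewrite leq_eqVlt => /predU1P[<-|ki]; first by rewrite mulmxA.
  by rewrite mulmxA fA // fB.
case: k kd {fA} IH @x x1 xi => [|k] kd IH x x1 xi.
  have [B sB xB] : exists2 A, swap_spec x (ev 0) A & x *m A = ev 0.
    by apply: swapP; rewrite x1 dotv_evv.
  exists B, B; split=> //.
  - case: sB => [_ -> //|u a u1 uE ->].
    (* Here x is on the axis of e_0, so the unit normal u is e_0 or -e_0, and both give the same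
       reflection. *)
    have xE : x = x 0 (Ordinal kd) *: ev 0.
      apply: row_ev_eq => -[[|i] ilt]; rewrite dotvZl dotv_evv //=.
        by rewrite mulr1 -dotv_ev.
      by rewrite mulr0 (xi (Ordinal ilt)).
    have {}uE : u = (a * (x 0 (Ordinal kd) - 1)) *: ev 0.
      by rewrite uE {1}xE -scalerA scalerBl scale1r.
    have := u1 => /sphereE; rewrite uE !dotvE dotv_evv // mulr1 -expr2 => /eqP.
    rewrite sqrf_eq1.
    by case/orP => /eqP ->; rewrite ?scaleN1r ?scale1r ?reflmxN; exact: K0.
  - exact: swap_orthogonal sB.
  - exact: swapK sB.
  - move=> i i0; apply: (swap_fix sB); first by rewrite dotvC xi.
    by rewrite dotv_evv // ltn_eqF.
have kd' := ltnW kd.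
(* w is the component of x along e_0, ..., e_k and b its length; g will turn w into b e_k while
   fixing e_(k+1). *)
pose c := dotv x (ev k.+1); pose w := x - c *: ev k.+1.
pose b := Num.sqrt (dotv w w).
have wi (i : 'I_d) : (k < i)%N -> dotv w (ev i) = 0.
  rewrite leq_eqVlt !dotvE dotv_evv // => /predU1P[<-|ki].
    by rewrite eqxx mulr1 subrr.
  by rewrite xi // gtn_eqF // mulr0 subrr.
have bb : b ^+ 2 = dotv w w by rewrite sqr_sqrtr // dotv_ge0.
have wb : dotv w w = dotv (b *: ev k) (b *: ev k).
  by rewrite -bb !dotvE dotv_evv // eqxx mulr1 expr2.
have bc : b ^+ 2 + c ^+ 2 = 1.
  rewrite bb -x1 /w !dotvE (dotvC (ev _) x) dotv_evv // eqxx /= -/c; ring.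
have [g sg wg] := swapP wb.
have fg (i : 'I_d) : (k < i)%N -> ev i *m g = ev i.
  move=> ki; apply: (swap_fix sg); first by rewrite dotvC wi.
  by rewrite dotvZr dotv_evv // ltn_eqF ?mulr0.
have Kg : K g by apply: IH => //; [exact: swap_orthogonal sg].
pose y := b *: ev k + c *: ev k.+1.
have xg : x *m g = y.
  by rewrite -[x](subrK (c *: ev k.+1)) mulmxDl wg -scalemxAl (fg (Ordinal kd)).
have [h sh yh] : exists2 A, swap_spec y (ev k.+1) A & y *m A = ev k.+1.
  apply: swapP; rewrite -xg dotv_mul ?dotv_evv ?eqxx //; exact: swap_orthogonal sg.
have Kh : K h.
  case: sh => [_ -> //|u a u1 uE ->].
  have {}uE : u = (a * b) *: ev k + (a * (c - 1)) *: ev k.+1.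
    by rewrite uE -!scalerA -scalerDr scalerBl scale1r addrA.
  rewrite uE; apply: Kc => //; move/sphereE: u1.
  rewrite uE !dotvE !dotv_evv // !eqxx gtn_eqF // ltn_eqF //= => u2.
  by rewrite -[RHS]u2; ring.
(* Both factors are involutions, so reversing their order inverts the product. *)
exists (g *m h), (h *m g); split.
- exact: KM.
- by apply: orthogonal_mul; [exact: swap_orthogonal sg|exact: swap_orthogonal sh].
- by rewrite mulmxA -(mulmxA g) (swapK sh) mulmx1 (swapK sg).
- by rewrite mulmxA xg.
- move=> i ki; rewrite mulmxA fg ?(ltnW ki) //.
  have ki' := ltnW ki; apply: (swap_fix sh); last by rewrite dotv_evv // ltn_eqF.
  by rewrite dotvDr !dotvZr !dotv_evv // !ltn_eqF // !mulr0 addr0.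
Qed.

End EuclideanGeometry.

(** * Closures of matrix groups and density in a coordinate plane *)

Section Density.
Variable R : realType.

Definition silver : R := Num.sqrt 2 - 1.

Lemma silver_sqr : silver * silver = 1 - 2 * silver.
Proof.
have s2 : (Num.sqrt 2 : R) ^+ 2 = 2 by rewrite sqr_sqrtr.
have -> : silver * silver = (Num.sqrt 2 : R) ^+ 2 - 2 * Num.sqrt 2 + 1.
  by rewrite /silver; ring.
by rewrite s2 /silver; ring.
Qed.

Lemma silver_itv : 0 < silver < 1 / 2.
Proof.
have s2 : (Num.sqrt 2 : R) ^+ 2 = 2 by rewrite sqr_sqrtr.
have s0 : (0 : R) <= Num.sqrt 2 := sqrtr_ge0 _.
by apply/andP; rewrite /silver; split; nra.
Qed.

(** [P] is an additive group; by s ^ (k+2) = s ^ k - 2 s ^ (k+1) it contains every c s ^ k, hence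
    arbitrarily small positive elements and all their integer multiples. *)
Lemma dense_silver_multiples (P : set R) c : 0 < c ->
    (forall x y, P x -> P y -> P (x - y)) -> P c -> P (c * silver) ->
  forall t e, 0 < e -> exists2 x, P x & `|t - x| < e.
Proof.
move=> c0 PB Pc Pcs t e e0.
have /andP[s0 s12] := silver_itv.
have P0 : P 0 by rewrite -(subrr c); exact: PB.
have PN x : P x -> P (- x) by move=> Px; rewrite -sub0r; exact: PB.
have PD x y : P x -> P y -> P (x + y).
  by move=> Px Py; rewrite -[y]opprK; apply: PB => //; exact: PN.
have Pn x n : P x -> P (x *+ n).
  by move=> Px; elim: n => [//|n IH]; rewrite mulrS; exact: PD.
have Pz x (m : int) : P x -> P (x *~ m).
  by move=> Px; case: m => n; [exact: Pn|exact/PN/Pn].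
have Pk k : P (c * silver ^+ k) /\ P (c * silver ^+ k.+1).
  elim: k => [|k [IH IH1]]; first by rewrite mulr1 expr1.
  split=> //; suff -> : c * silver ^+ k.+2 =
      c * silver ^+ k - (c * silver ^+ k.+1) *+ 2 by apply: PB => //; exact: Pn.
  transitivity (c * silver ^+ k * (silver * silver)); first by rewrite !exprS; ring.
  by rewrite silver_sqr exprS; ring.
have [k ke] : exists k, c * silver ^+ k < e.
  have ec0 : 0 < e / c by rewrite divr_gt0.
  have [k _ kP] := near_infty_natSinv_expn_lt (PosNum ec0).
  exists k; rewrite mulrC -ltr_pdivlMr //; apply: le_lt_trans (kP k (leqnn k)).
  have -> : 1 / 2 ^+ k = (1 / 2) ^+ k :> R by rewrite expr_div_n expr1n.
  by apply: lerXn2r; rewrite ?nnegrE ?ltW //; lra.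
set x := c * silver ^+ k in ke.
have x0 : 0 < x by rewrite mulr_gt0 // exprn_gt0.
(* The largest multiple of x not exceeding t misses t by less than x < e. *)
exists (x *~ Num.floor (t / x)); first exact/Pz/(Pk k).1.
have /andP[] := floor_itv (t / x).
rewrite ler_pdivlMr // ltr_pdivrMr // intrD mulrDl mul1r (mulrzl x) => h1 h2.
rewrite ger0_norm ?subr_ge0 //; apply: lt_trans ke.
by rewrite ltrBlDl.
Qed.

Lemma continuous_mx m n (T : topologicalType) (f : T -> 'M[R]_(m, n)) :
  (forall i j, continuous (fun t => f t i j)) -> continuous f.
Proof.
move=> fc t B [P tP PB]; rewrite nbhs_simpl.
have : \forall u \near t, forall i j, P i j (f u i j).
  by apply: filter_forall => i; apply: filter_forall => j; exact/fc/tP.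
by apply: filterS => u uP; exact: PB.
Qed.

Lemma continuous_mulmx m n p (T : topologicalType)
    (f : T -> 'M[R]_(m, n)) (g : T -> 'M[R]_(n, p)) :
  (forall i j, continuous (fun t => f t i j)) ->
  (forall i j, continuous (fun t => g t i j)) ->
  continuous (fun t => f t *m g t).
Proof.
move=> fc gc; apply: continuous_mx => i j.
have -> : (fun t => (f t *m g t) i j) = fun t => \sum_k f t i k * g t k j.
  by apply/funext => t; rewrite mxE.
move=> t; apply: cvg_big => [|k _]; first exact: add_continuous.
by apply: cvgM; [exact: fc|exact: gc].
Qed.

(** The preimage of [closure A] under [f] is closed and contains [A]. *)
Lemma closure_preserved (T : topologicalType) (A : set T) (f : T -> T) :
  continuous f -> (forall x, A x -> closure A (f x)) ->
  forall x, closure A x -> closure A (f x).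
Proof.
move=> /continuous_closedP fc fA; rewrite [X in forall x, X x -> _]closureE.
apply: (@smallest_sub _ closed A (f @^-1` closure A) _ fA).
by apply: (fc _ _); exact: closed_closure.
Qed.

(** The factors pass to the closure one after the other, so continuity in each variable separately
    is enough. *)
Lemma closure_mulmx n (H : set 'M[R]_n) :
  (forall A B, H A -> H B -> H (A *m B)) ->
  forall A B, closure H A -> closure H B -> closure H (A *m B).
Proof.
move=> HM; have cst (C : 'M[R]_n) i j : continuous (fun X : 'M[R]_n => C i j).
  exact: cst_continuous.
have crd i j : continuous (fun X : 'M[R]_n => X i j) by exact: coord_continuous.
move=> A B KA KB.
apply: (@closure_preserved _ H (mulmxr B)) KA; first exact: continuous_mulmx.
move=> C HC; apply: (@closure_preserved _ H (mulmx C)) KB.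
  exact: continuous_mulmx.
by move=> D HD; apply: subset_closure; exact: HM.
Qed.

Variable d : nat.

Definition circle (k : nat) (t : R) : 'rV[R]_d :=
  cos t *: ev R d k + sin t *: ev R d k.+1.

Lemma dotv_circle k t u : (k.+1 < d)%N ->
  dotv (circle k t) (circle k u) = cos (t - u).
Proof.
move=> kd; rewrite !dotvE !dotv_evv ?(ltnW kd) // !eqxx gtn_eqF // ltn_eqF //=.
by rewrite cosB; ring.
Qed.

Lemma sphere_circle k t : (k.+1 < d)%N -> sphere (circle k t).
Proof. by move=> kd; apply/sphereE; rewrite dotv_circle // subrr cos0. Qed.

Lemma reflmx_circleDpi k t : reflmx (circle k (t + pi)) = reflmx (circle k t).
Proof.
by rewrite -[RHS]reflmxN /circle cosDpi sinDpi !scaleNr opprD.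
Qed.

(** The reflection with normal at angle t sends the direction at angle u to the opposite of the one
    at angle 2 t - u, and the sign of a normal is immaterial. *)
Lemma reflmx_circle_conj k t u : (k.+1 < d)%N ->
  reflmx (circle k t) *m reflmx (circle k u) *m reflmx (circle k t) =
  reflmx (circle k (2 * t - u)).
Proof.
move=> kd; rewrite reflmx_conj; last exact: sphere_circle.
rewrite -[RHS]reflmxN; congr (reflmx _).
rewrite /refl dotv_circle // /circle.
rewrite (_ : 2 * t - u = t - (u - t)); last by ring.
have cE : cos u = cos t * cos (u - t) - sin t * sin (u - t).
  by rewrite -cosD addrC subrK.
have sE : sin u = sin t * cos (u - t) + cos t * sin (u - t).
  by rewrite -sinD addrC subrK.
apply/rowP => j; rewrite !mxE (cosB t) (sinB t) cE sE.
set p := cos (u - t); set q := sin (u - t).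
by ring.
Qed.

Lemma continuous_reflmx_circle k : continuous (fun t => reflmx (circle k t)).
Proof.
have cc (l : 'I_d) : continuous (fun t => circle k t 0 l).
  have -> : (fun t => circle k t 0 l) = fun t => cos t * (l == k :> nat)%:R
    + sin t * (l == k.+1 :> nat)%:R by apply/funext => t; rewrite !mxE.
  move=> t; apply: cvgD; apply: cvgMl; first exact: continuous_cos.
  exact: continuous_sin.
have rE (u : 'rV[R]_d) i j : reflmx u i j = (i == j)%:R - 2 * (u 0 i * u 0 j) :> R.
  have ei : delta_mx 0 i = ev R d i by apply/rowP => l; rewrite !mxE eqxx.
  by rewrite mxE /refl ei dotvC dotv_ev !mxE eq_sym mulrA.
apply: continuous_mx => i j.
have -> : (fun t => reflmx (circle k t) i j) = fun t => (i == j)%:R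
    - 2 * (circle k t 0 i * circle k t 0 j) by apply/funext => t; rewrite rE.
move=> t; apply: cvgB; first exact: cvg_cst.
by apply: cvgMr; apply: cvgM; exact: cc.
Qed.

Lemma reflmx_circle_dense (K : set 'M[R]_d) k : (k.+1 < d)%N ->
    closed K -> (forall A B, K A -> K B -> K (A *m B)) ->
    K (reflmx (circle k 0)) -> K (reflmx (circle k (pi * silver))) ->
  forall t, K (reflmx (circle k t)).
Proof.
move=> kd clK KM K0 K1.
pose S := [set t | K (reflmx (circle k t))].
have S2 t u : S t -> S u -> S (2 * t - u).
  move=> St Su; rewrite /S /= -reflmx_circle_conj //.
  by apply: (KM) => //; exact: KM.
have SN t : S t -> S (- t).
  by move=> St; rewrite -sub0r -[X in X - _](mulr0 2); exact: S2.
(* The periods of S are stable under differences because S is symmetric about 0. *)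
pose P := [set x | forall t, S t -> S (t + x)].
have PB x y : P x -> P y -> P (x - y).
  move=> Px Py t St; rewrite (_ : t + (x - y) = - (- (t + x) + y)); last by ring.
  by apply: (SN); apply: Py; apply: SN; exact: Px.
have P1 : P (2 * pi).
  by move=> t St; rewrite /S /= mulr_natl mulr2n addrA !reflmx_circleDpi.
have P2 : P (2 * pi * silver).
  (* The symmetries of S about 0 and about pi s compose to the translation by 2 pi s. *)
  move=> t St; rewrite (_ : t + _ = 2 * (pi * silver) - (- t)); last by ring.
  by apply: S2 => //; exact: SN.
have SS : closed S.
  by move/continuous_closedP : (@continuous_reflmx_circle k); exact.
move=> t; apply: SS => B /nbhs_ballP[e /= e0 eB].
have pp : 0 < 2 * pi :> R by rewrite mulr_gt0 // pi_gt0.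
have [x Px tx] := dense_silver_multiples pp PB P1 P2 t e0.
(* Since 0 is in S, each period is itself in S. *)
by exists x; split; [rewrite -[x]add0r; exact: Px|exact: eB].
Qed.

Lemma exists_angle (a b : R) : a ^+ 2 + b ^+ 2 = 1 ->
  exists t, a = cos t /\ b = sin t.
Proof.
move=> ab; have a1 : -1 <= a <= 1 by apply/andP; split; nra.
have ca : cos (acos a) = a by rewrite acosK // in_itv.
have sa : sin (acos a) = `|b|.
  by rewrite sin_acos // -ab addrC addKr sqrtr_sqr.
have [b0|b0] := leP 0 b.
  by exists (acos a); rewrite ca sa ger0_norm.
by exists (- acos a); rewrite cosN sinN ca sa ltr0_norm // opprK.
Qed.

End Density.

(** * The lower bound and the chain of directions *)

Section Directions.
Variables (R : realType) (d : nat).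
Implicit Types (G : set 'rV[R]_d) (x u : 'rV[R]_d).

(** A listing by d indices that may repeat, or leave [G], treats all sets of at most d directions at
    once. *)
Lemma surj_not_halfspaces_cover (g : 'I_d -> 'rV[R]_d) G : (0 < d)%N ->
  (forall u, G u -> exists i, g i = u) -> ~ halfspaces_cover G.
Proof.
move=> d0 gG covG.
pose A := (\matrix_i g i)^T.
have AE x i : (x *m A) 0 i = dotv x (g i).
  by rewrite mxE; apply: eq_bigr => j _; rewrite !mxE.
have [x x0 xg] : exists2 x, x != 0 & forall i, dotv x (g i) <= 0.
  have [/det0P[x x0 xA]|A0] := boolP (\det A == 0).
    by exists x => // i; rewrite -AE xA mxE.
  pose x : 'rV_d := const_mx (- 1) *m invmx A.
  have xA : x *m A = const_mx (- 1) by rewrite mulmxKV // unitmxE unitfE.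
  exists x; last by move=> i; rewrite -AE xA mxE lerN10.
  apply/eqP => x0; move/rowP/(_ (Ordinal d0)) : xA => /eqP.
  by rewrite x0 mul0mx !mxE eq_sym oppr_eq0 oner_eq0.
(* Covering concerns unit vectors only; a positive rescaling of x keeps the signs. *)
have [c c0 /covG[u /gG[i <-]]] := normalized x0.
by rewrite /halfspace /= dotvZl pmulr_rgt0 // ltNge xg.
Qed.

Lemma halfspaces_cover_card G : (0 < d)%N -> halfspaces_cover G ->
  (`I_d.+1 #<= G)%card.
Proof.
move=> d0 covG; have [finG|/infiniteP] := pselect (finite_set G); last first.
  exact/card_le_trans/subset_card_le.
have /finite_setP[n Gn] := finG.
rewrite (card_le_eqr Gn) card_le_II ltnNge; apply/negP => nd.
have /pcard_geP/unsquash f : (G #<= `I_d)%card.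
  by rewrite (card_le_eql Gn) card_le_II.
apply: (@surj_not_halfspaces_cover (fun i => f i) G) => // u Gu.
by have [i /= id <-] := surj (f := f) Gu; exists (Ordinal id).
Qed.

Lemma orthogonal_group_subgroup : orthogonal_subgroup (@orthogonal_group R d).
Proof.
split=> //; first by rewrite /orthogonal_group /= trmx1 mulmx1.
  exact: orthogonal_mul.
move=> A AA; have [uA _] := mulmx1_unit AA.
have -> : invmx A = A^T by rewrite -[RHS](mulKmx uA) AA mulmx1.
by rewrite /orthogonal_group /= trmxK; exact: mulmx1C.
Qed.

Lemma sub_refl_group G u : G u -> refl_group G (reflmx u).
Proof. by move=> Gu M [_]; apply; exists u. Qed.

Lemma refl_group_orthogonal G : G `<=` @sphere R d ->
  refl_group G `<=` @orthogonal_group R d.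
Proof.
move=> G1; apply: smallest_sub; first exact: orthogonal_group_subgroup.
by move=> _ [u /G1 u1 <-]; exact: reflmx_orthogonal.
Qed.

Lemma refl_group1 G : refl_group G 1%:M.
Proof. by move=> M [[]]. Qed.

Lemma refl_groupM G A B :
  refl_group G A -> refl_group G B -> refl_group G (A *m B).
Proof.
move=> GA GB M HM; have [[_ _ MM _] _] := HM.
by apply: MM; [exact: GA|exact: GB].
Qed.

Definition chain (k : nat) : 'rV[R]_d :=
  if k is k'.+1 then circle d k' (pi * silver R) else ev R d 0.

Lemma sphere_chain k : (k < d)%N -> sphere (chain k).
Proof.
case: k => [|k] kd; last exact: sphere_circle.
by apply/sphereE; rewrite dotv_evv.
Qed.

Lemma sin_angle_gt0 : 0 < sin (pi * silver R).
Proof.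
have /andP[s0 s1] := silver_itv R.
apply: sin_gt0_pi; rewrite mulr_gt0 ?pi_gt0 //=.
by rewrite -[ltRHS]mulr1 ltr_pM2l ?pi_gt0 //; lra.
Qed.

(** With [chain_coord_gt0], this makes the coordinates of the chain a triangular matrix with
    positive diagonal, which serves to tell the directions apart. *)
Lemma chain_coord_eq0 k i : (k < i)%N -> (i < d)%N ->
  dotv (chain k) (ev R d i) = 0.
Proof.
case: k => [|k] ki id; first by rewrite dotv_evv // gtn_eqF.
by rewrite /= !dotvE !dotv_evv // !gtn_eqF // ?(ltnW ki) // !mulr0 addr0.
Qed.

Lemma chain_coord_gt0 k : (k < d)%N -> 0 < dotv (chain k) (ev R d k).
Proof.
case: k => [|k] kd; first by rewrite dotv_evv.
by rewrite /= !dotvE !dotv_evv // eqxx gtn_eqF // mulr0 add0r mulr1 sin_angle_gt0.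
Qed.

(** Forward substitution: once the k-th coordinate of x vanishes, orthogonality to [chain k.+1]
    leaves sin (pi s) times the next coordinate. *)
Lemma chain_spans x : (forall k, (k < d)%N -> dotv x (chain k) = 0) -> x = 0.
Proof.
move=> xc; suff xk k : (k < d)%N -> dotv x (ev R d k) = 0.
  by apply: row_ev_eq => i; rewrite dotv0l xk.
elim: k => [|k IH] kd; first exact: (xc 0 kd).
have := xc _ kd; rewrite /= !dotvE IH ?(ltnW kd) // mulr0 add0r => /eqP.
by rewrite mulf_eq0 gt_eqF ?sin_angle_gt0 //= => /eqP.
Qed.

Definition chain_sum : 'rV[R]_d := \sum_(k < d) chain k.

(** Only the last chain vector reaches the last axis. This makes the sum nonzero and separates its
    opposite from the chain. *)
Lemma chain_sum_coord_gt0 : (0 < d)%N -> 0 < dotv chain_sum (ev R d d.-1).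
Proof.
move=> d0; have dd : (d.-1 < d)%N by rewrite prednK.
rewrite dotv_suml (bigD1 (Ordinal dd)) //= big1 ?addr0.
  exact: chain_coord_gt0.
move=> i ni; apply: chain_coord_eq0 => //.
by rewrite ltn_neqAle ni -ltnS prednK ?ltn_ord.
Qed.

Lemma chain_reflections_dense G : G `<=` @sphere R d ->
  (forall k, (k < d)%N -> G (chain k)) -> reflections_generate_dense G.
Proof.
move=> G1 Gc; split; first exact: refl_group_orthogonal.
set K := closure (refl_group G).
have KM A B : K A -> K B -> K (A *m B).
  by apply: closure_mulmx; exact: refl_groupM.
have Kc k : (k < d)%N -> K (reflmx (chain k)).
  by move=> kd; apply: subset_closure; apply: sub_refl_group; exact: Gc.
have dense k : (k.+1 < d)%N -> K (reflmx (ev R d k)) ->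
    forall t, K (reflmx (circle d k t)).
  move=> kd Kk; apply: reflmx_circle_dense => //; first exact: closed_closure.
    by rewrite /circle cos0 sin0 scale1r scale0r addr0.
  exact: (Kc k.+1).
(* The reflection along e_k opens up the plane of e_k and e_(k+1); angle pi / 2 there yields
   e_(k+1), where the next plane starts. *)
have Kev k : (k < d)%N -> K (reflmx (ev R d k)).
  elim: k => [|k IH] kd; first exact: (Kc 0).
  have := dense k kd (IH (ltnW kd)) (pi / 2).
  by rewrite /circle cos_pihalf sin_pihalf scale1r scale0r add0r.
apply: orthogonal_generated => //.
- by apply: subset_closure; exact: refl_group1.
- exact: Kev.
- move=> k a b kd /exists_angle[t [-> ->]].
  by apply: dense => //; apply: Kev; exact: ltnW.
Qed.

End Directions.

Theorem proposition4p3 (R : realType) (d : nat) (hd : (0 < d)%N) :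
  (forall G : set 'rV[R]_d,
      G `<=` @sphere R d ->
      halfspaces_cover G ->
      reflections_generate_dense G ->
      (`I_d.+1 #<= G)%card) /\
  (exists G : set 'rV[R]_d,
      [/\ G `<=` @sphere R d,
          (G #= `I_d.+1)%card,
          halfspaces_cover G &
          reflections_generate_dense G]).
Proof.
split=> [G _ covG _|]; first exact: halfspaces_cover_card.
have sum_gt0 := chain_sum_coord_gt0 R hd.
have sum0 : chain_sum R d != 0.
  by apply: contraTneq sum_gt0 => ->; rewrite dotv0l ltxx.
have [c c0 c1] := normalized sum0.
pose f k := if (k < d)%N then chain R d k else - (c *: chain_sum R d).
have fE k : (k < d)%N -> f k = chain R d k by rewrite /f => ->.
have fd : f d = - (c *: chain_sum R d) by rewrite /f ltnn.
have f1 k : sphere (f k).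
  rewrite /f; case: ifP => [/sphere_chain //|_]; apply/sphereE.
  by rewrite dotvNl dotvNr opprK; exact/sphereE.
have fP k : (k < d.+1)%N -> (k < d)%N \/ k = d.
  by rewrite ltnS leq_eqVlt => /predU1P[->|]; [right|left].
exists (f @` `I_d.+1); split.
- by move=> _ [k _ <-].
- apply: inj_card_eq.
  (* For j < d the j-th coordinate separates the two; for j = d the last one does, being nonnegative
     on the chain and negative on the extra direction. *)
  have flt i j : (i < j)%N -> (j < d.+1)%N -> f i <> f j.
    move=> ij /fP[jd|jd]; last subst j.
      rewrite !fE ?(ltn_trans ij) // => fij.
      by have := chain_coord_gt0 R jd; rewrite -fij chain_coord_eq0 // ltxx.
    rewrite fd fE // => fid.
    have dd : (d.-1 < d)%N by rewrite prednK.
    have : 0 <= dotv (chain R d i) (ev R d d.-1).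
      have : (i <= d.-1)%N by rewrite -ltnS prednK.
      rewrite leq_eqVlt => /predU1P[->|id]; last by rewrite chain_coord_eq0.
      exact/ltW/chain_coord_gt0.
    by rewrite fid dotvNl dotvZl oppr_ge0 leNgt mulr_gt0.
  move=> i j /set_mem id /set_mem jd fij.
  by case: (ltngtP i j) => // [/flt/(_ jd)|/flt/(_ id) ji]; [|case: ji].
(* For an uncovered x all x . u_k are at most 0, while the extra direction forces their sum to be at
   least 0. All of them vanish, so x = 0. *)
- move=> x x1; apply: contrapT => ncov.
  have xf k : (k < d.+1)%N -> dotv x (f k) <= 0.
    move=> kd; rewrite leNgt; apply/negP => xk; apply: ncov.
    by exists (f k) => //; exists k.
  have xc (k : 'I_d) : dotv x (chain R d k) <= 0.
    by rewrite -fE // xf // ltnW // ltnS.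
  have sum_ge0 : 0 <= \sum_(k < d) dotv x (chain R d k).
    have := xf d (ltnSn d); rewrite fd dotvNr dotvZr oppr_le0 pmulr_rge0 //.
    by rewrite dotvC dotv_suml; under eq_bigr do rewrite dotvC.
  have : \sum_(k < d) - dotv x (chain R d k) == 0.
    rewrite eq_le sumrN oppr_le0 sum_ge0 -sumrN sumr_ge0 // => k _.
    by rewrite oppr_ge0.
  rewrite psumr_eq0 => [/allP xz|k _]; last by rewrite oppr_ge0.
  have x0 : x = 0.
    apply: (@chain_spans R d) => k kd; apply/eqP; rewrite -oppr_eq0.
    exact: (xz (Ordinal kd) (mem_index_enum _)).
  by move/sphereE/eqP : x1; rewrite x0 dotv0l eq_sym oner_eq0.
- apply: chain_reflections_dense => [_ [k _ <-] //|k kd].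
  by exists k; [exact: ltnW|rewrite fE].
Qed.
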